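(* Fix an integer $q\ge3$ and $0\le B<\log(q-1)$. Let $W$ be a random variable whose distribution has support contained in a compact set $[w',w]$ with $w'>0$ and $$\frac{w}{w'}\le1+\frac{\log(2+\sqrt3)}{\log(q-1)-B}.$$ Then $t\mapsto\frac{d^2}{dt^2}\mathscr{F}_B(t)$ is first positive and then negative.
   Context: For $t\ge0$, $\mathscr{F}_B(t)=\mathbb{E}\Big[\frac{W}{\mathbb{E}[W]}\,\frac{\mathrm{e}^{tW+B}-1}{\mathrm{e}^{tW+B}+q-1}\Big]$. ''First positive and then negative'' means that there is a $t_*>0$ with $\frac{d^2}{dt^2}\mathscr{F}_B(t)>0$ for $0<t<t_*$ and $\frac{d^2}{dt^2}\mathscr{F}_B(t)<0$ for $t>t_*$. *)

(* Defs.v *)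
From HB Require Import structures.
From mathcomp Require Import all_boot all_order all_algebra.
From mathcomp Require Import all_classical all_reals all_analysis.

Set Implicit Arguments.
Unset Strict Implicit.
Unset Printing Implicit Defensive.

Import Order.TTheory GRing.Theory Num.Theory.
Import numFieldNormedType.Exports.

Local Open Scope classical_set_scope.
Local Open Scope ring_scope.

Definition msupport (R : realType) (T : topologicalType)
    (mu : set T -> \bar R) : set T :=
  [set x | forall U : set T, open U -> U x -> (0 < mu U)%E].

(* ['E_P[_]] is extended-real valued; both expectations below are finite when
   [W] is bounded, so [fine] loses nothing in that case. The formula is used
   for every real [t]; only its values at [t >= 0] are meaningful. *)
Definition FB (d : measure_display) (T : measurableType d) (R : realType)
    (P : probability T R) (W : {RV P >-> R}) (q : nat) (B : R) (t : R) : R :=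
  let EW := fine ('E_P[W])%E in
  fine ('E_P[(fun x : T =>
    W x / EW *
    ((expR (t * W x + B) - 1) / (expR (t * W x + B) + q%:R - 1)))%R])%E.

Definition first_pos_then_neg (R : realType) (g : R -> R) : Prop :=
  exists tstar : R, [/\ 0 < tstar,
    forall t : R, 0 < t < tstar -> 0 < g t &
    forall t : R, tstar < t -> g t < 0].

(* [derive1] is total, so the existence of the second derivative is
   a statement of its own. *)
Definition twice_derivable_pos (R : realType) (f : R -> R) : Prop :=
  forall t : R, 0 < t -> derivable f t 1 /\ derivable (derive1 f) t 1.

(* Main.v *)
(* With a = q - 1 the logistic function f(s) = (e^s - 1) / (e^s + a) gives
   F''(t) = E[W^3 f''(tW + B)] / E[W], and f'' is positive left of ln a,
   negative right of ln a, and strictly decreasing where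
   |s - ln a| <= ln (2 + sqrt 3). Put L = ln a - B > 0. Then F'' > 0 for
   t < L/w and F'' < 0 for t > L/w', because tW + B stays on one side of ln a.
   For L/w <= t <= L/w' the hypothesis on w/w' keeps
   |tW + B - ln a| <= ln (2 + sqrt 3), so F'' is strictly decreasing there and
   changes sign once. *)

Require Import Defs.
From HB Require Import structures.
From mathcomp Require Import all_boot all_order all_algebra.
From mathcomp Require Import all_classical all_reals all_analysis.
From mathcomp Require Import measurable_realfun lebesgue_integral_under.
From mathcomp Require Import ring lra.
Import Order.TTheory GRing.Theory Num.Theory.
Import numFieldNormedType.Exports.
Local Open Scope classical_set_scope.
Local Open Scope ring_scope.

(** * Null sets, strict positivity of integrals, restriction to a full event *)

(** Each point outside the support has an open null neighbourhood, which contains a null ball with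
    rational centre and radius around the point. There are countably many such balls, so their union
    is negligible. *)
Lemma negligible_setC_msupport (R : realType)
    (mu : {measure set R -> \bar R}) (C : set R) :
  msupport (mu : set R -> \bar R) `<=` C -> mu.-negligible (~` C).
Proof.
move=> muC.
(* Enumerates the null rational balls; codes of other balls, or of nothing, give the empty set. *)
pose F n : set R := if unpickle n is Some cr then
  let A : set R := ball (ratr cr.1 : R) (ratr cr.2 : R) in
  if mu A == 0%E then A else set0 else set0.
have negF k : mu.-negligible (F k).
  rewrite /F; case: unpickle => [[c r]|] /=; last exact: negligible_set0.
  case: ifPn => [/eqP mu0|_]; last exact: negligible_set0.
  by exists (ball (ratr c : R) (ratr r : R)); split => //; exact: measurable_ball.
apply: (@negligibleS _ _ _ mu (\bigcup_k F k)); last exact: negligible_bigcup.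
move=> x Cx.
have /existsNP[U /not_implyP[oU /not_implyP[Ux mU]]] := contra_not (muC x) Cx.
have [c [r [/set_mem xB BU]]] := open_subball_rat oU (mem_set Ux).
have muB0 : mu (ball (ratr c : R) (ratr r : R)) == 0%E.
  rewrite -measure_le0 (le_trans _ (_ : mu U <= 0)%E)//.
    by rewrite le_measure ?inE//; [exact: measurable_ball|exact: open_measurable].
  by rewrite leNgt; exact/negP.
exists (pickle (c, r)); first exact: I.
by rewrite /F pickleK /= muB0.
Qed.

(** A nonnegative function with zero integral vanishes almost everywhere; if it is positive on all
    of [D], this forces [D] to be null. *)
Lemma Rintegral_gt0 {d} {T : measurableType d} {R : realType}
    (mu : {measure set T -> \bar R}) (D : set T) (f : T -> R) :
  measurable D -> mu D != 0%E -> mu.-integrable D (EFin \o f) ->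
  (forall x, D x -> 0 < f x) -> 0 < \int[mu]_(x in D) f x.
Proof.
move=> mD D0 intf f0.
rewrite lt_neqAle Rintegral_ge0 ?andbT; last by move=> x /f0/ltW.
apply: contra D0; rewrite eq_sym /Rintegral fine_eq0; last exact: integrable_fin_num.
move=> /eqP if0; have mf : measurable_fun D (EFin \o f) by case/integrableP: intf.
have /ae_eq_integral_abs : (\int[mu]_(x in D) `|(EFin \o f) x| = 0)%E.
  rewrite -[RHS]if0; apply: eq_integral => x /set_mem Dx /=.
  by rewrite gtr0_norm ?f0.
move=> /(_ mD mf) aef; apply/eqP/negligibleP => //.
apply: negligibleS aef => x Dx /= aex.
by have [fx0] := aex Dx; have := f0 _ Dx; rewrite fx0 ltxx.
Qed.

Lemma lt_Rintegral {d} {T : measurableType d} {R : realType}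
    (mu : {measure set T -> \bar R}) (D : set T) (f g : T -> R) :
  measurable D -> mu D != 0%E ->
  mu.-integrable D (EFin \o f) -> mu.-integrable D (EFin \o g) ->
  (forall x, D x -> f x < g x) ->
  \int[mu]_(x in D) f x < \int[mu]_(x in D) g x.
Proof.
move=> mD D0 intf intg fg; rewrite -subr_gt0 -RintegralB//.
apply: Rintegral_gt0 => // [|x Dx]; last by rewrite subr_gt0 fg.
have -> : EFin \o (fun x => g x - f x) = ((EFin \o g) \- (EFin \o f))%E.
  by apply/funext => x /=; rewrite EFinB.
exact: integrableB.
Qed.

(** Replaces an expectation by an integral over an event on which pointwise bounds hold everywhere:
    [X] and its restriction to [D] agree almost everywhere. *)
Lemma fine_expectation_negligible {d} {T : measurableType d} {R : realType}
    (P : probability T R) (D : set T) (X : T -> R) :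
  measurable D -> P.-negligible (~` D) -> measurable_fun setT X ->
  fine ('E_P[X])%E = \int[P]_(x in D) X x.
Proof.
move=> mD D0 mX; rewrite unlock /Rintegral; congr fine.
rewrite [RHS]integral_mkcond; apply: ae_eq_integral => //.
- exact/measurable_EFinP.
- apply/measurable_restrict => //; rewrite setTI.
  exact/measurable_EFinP/measurable_funTS.
- apply: negligibleS D0 => x /= nX Dx; apply: nX => _.
  by rewrite patchE mem_set.
Qed.

Lemma derivable_measurable_fun (R : realType) (f : R -> R) :
  (forall s : R, derivable f s 1) -> measurable_fun setT f.
Proof.
move=> df; apply: continuous_measurable_fun => s.
exact/differentiable_continuous/derivable1_diffP.
Qed.

(** * Differentiation under the expectation *)

Section bounded_comp_under_expectation.
Context {d} {T : measurableType d} {R : realType} (P : probability T R).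
Variables (D : set T) (V W : T -> R) (CV CW M B : R) (phi : R -> R).
Hypotheses (mD : measurable D) (mV : measurable_fun D V)
  (mW : measurable_fun D W) (V_le : forall x, D x -> `|V x| <= CV)
  (phi_le : forall s : R, `|phi s| <= M).

Let integrand t x := V x * phi (t * W x + B).

Lemma integrable_mul_bounded_comp (t : R) :
  measurable_fun setT phi -> P.-integrable D (EFin \o integrand t).
Proof.
move=> mphi; apply: measurable_bounded_integrable => //.
- by rewrite (le_lt_trans (probability_le1 _ _)) ?ltry.
- apply: measurable_funM => //; apply: (measurableT_comp mphi).
  by apply: measurable_funD => //; exact: measurable_funM.
- exists (CV * M); split; first exact: num_real.
  move=> K CMK x Dx; apply: le_trans (ltW CMK).
  by rewrite /integrand normrM ler_pM ?V_le.
Qed.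

(** Dominated differentiation: the [t]-derivative of the integrand is bounded by a constant, which
    is integrable for a probability. The weight [V] is kept general because each differentiation
    moves one factor [W] into it, so the lemma can be iterated. *)
Lemma is_derive_mul_bounded_comp (phi' : R -> R) (t : R) :
  (forall x, D x -> `|W x| <= CW) ->
  (forall s : R, is_derive s 1 phi (phi' s)) ->
  (forall s : R, `|phi' s| <= M) ->
  is_derive t 1 (fun t : R => \int[P]_(x in D) integrand t x)
    (\int[P]_(x in D) (V x * W x * phi' (t * W x + B))).
Proof.
move=> W_le dphi phi'_le.
have mphi : measurable_fun setT phi by exact: derivable_measurable_fun.
have d1 (s : R) x : is_derive s 1 (integrand ^~ x) (V x * W x * phi' (s * W x + B)).
  have dl : is_derive s 1 (W x *: id + cst B : R -> R) (W x).
    by apply: is_derive_eq; rewrite addr0 [LHS]mulr1.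
  have -> : integrand ^~ x = V x *: (phi \o (W x *: id + cst B)).
    by apply/funext => z; rewrite /integrand (mulrC z).
  apply: is_derive_eq.
  by rewrite -mulrA (mulrC (W x)) (mulrC s).
have pE : partial1of2 integrand t = fun x => V x * W x * phi' (t * W x + B).
  apply/funext => x; rewrite partial1of2E.
  exact: derive_val.
have It : `]t - 1, t + 1[%classic t by rewrite /= in_itv /=; lra.
(* The absolute value makes the dominating constant nonnegative even when [D] is empty and the
   bounds carry no sign. *)
pose K := `|CV * CW * M|.
have intG : P.-integrable D (EFin \o cst K).
  apply: measurable_bounded_integrable => //; last exact: bounded_cst.
  by rewrite (le_lt_trans (probability_le1 _ _)) ?ltry.
have G_ub x y : `]t - 1, t + 1[%classic x -> D y ->
    `|partial1of2 integrand x y| <= cst K y.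
  move=> _ Dy; rewrite partial1of2E derive_val !normrM.
  by rewrite (le_trans _ (@ler_norm R (CV * CW * M))) ?ler_pM//
    ?mulr_ge0 ?V_le ?W_le.
have der x y : `]t - 1, t + 1[%classic x -> D y -> derivable (integrand^~ y) x 1.
  by move=> _ _; exact: ex_derive.
have := @differentiation_under_integral R d T P integrand D mD t (t-1) (t+1) It
  (fun x _ => integrable_mul_bounded_comp x mphi) der (cst K) (fun=> normr_ge0 _) intG
  G_ub.
have := @derivable_under_integral R d T P integrand D mD t (t-1) (t+1) It
  (fun x _ => integrable_mul_bounded_comp x mphi) der (cst K) (fun=> normr_ge0 _) intG
  G_ub.
move=> dd; rewrite derive1E pE => <-; exact: DeriveDef.
Qed.

End bounded_comp_under_expectation.

(** * The logistic function and its first two derivatives *)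

Section logistic.
Context {R : realType}.
Implicit Types a s t : R.

Definition logistic a s := (expR s - 1) / (expR s + a).
Definition dlogistic a s := (a + 1) * expR s / (expR s + a) ^+ 2.
Definition ddlogistic a s := (a + 1) * expR s * (a - expR s) / (expR s + a) ^+ 3.

Lemma is_derive_div (f g : R -> R) (x df dg : R) : g x != 0 ->
  is_derive x 1 f df -> is_derive x 1 g dg ->
  is_derive x 1 (fun y => f y / g y) ((df * g x - f x * dg) / g x ^+ 2).
Proof.
move=> gx0 dfx dgx.
have dV := @is_deriveV R g x _ 1 gx0 dgx.
apply: (is_derive_eq (is_deriveM dfx dV)).
by rewrite /GRing.scale /=; field.
Qed.

Lemma is_derive_expRD a s : is_derive s 1 (fun s => expR s + a) (expR s).
Proof.
have := is_deriveD (is_derive_expR s) (is_derive_cst a s 1).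
by rewrite addr0.
Qed.

Lemma is_derive_logistic a s :
  0 <= a -> is_derive s 1 (logistic a) (dlogistic a s).
Proof.
move=> a0; have ea : expR s + a != 0 by rewrite gt_eqF// ltr_pwDl ?expR_gt0.
have d1 := @is_derive_div (fun s => expR s + -1) _ s _ _ ea
  (is_derive_expRD (-1) s) (is_derive_expRD a s).
by apply: (is_derive_eq d1); rewrite /dlogistic; field.
Qed.

Lemma is_derive_dlogistic a s :
  0 <= a -> is_derive s 1 (dlogistic a) (ddlogistic a s).
Proof.
move=> a0; have ea : expR s + a != 0 by rewrite gt_eqF// ltr_pwDl ?expR_gt0.
have d1 := @is_derive_div ((a + 1) *: expR) ((fun s => expR s + a) ^+ 2) s _ _
  (expf_neq0 2 ea) (is_deriveZ _ (is_derive_expR s)) (is_deriveX 2 (is_derive_expRD a s)).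
apply: (is_derive_eq d1); rewrite /ddlogistic.
(* Evaluates the function-level scaling and power at [s], leaving an identity of reals for
   [field]. *)
change (((a + 1) * expR s * (expR s + a) ^+ 2 -
  (a + 1) * expR s * (2 * (expR s + a) ^+ 1 * expR s)) /
  ((expR s + a) ^+ 2) ^+ 2 =
  (a + 1) * expR s * (a - expR s) / (expR s + a) ^+ 3).
by field.
Qed.

(** The crude bound [a + 1] is shared with both derivatives, so that a single [M] controls [phi] and
    [phi'] in [is_derive_mul_bounded_comp]. *)
Lemma norm_logistic_le a s : 1 <= a -> `|logistic a s| <= a + 1.
Proof.
move=> a1; have e0 := expR_gt0 s; rewrite /logistic ler_norml.
have d0 : 0 < expR s + a by lra.
by apply/andP; rewrite ler_pdivlMr ?ler_pdivrMr //; split; nra.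
Qed.

Lemma norm_dlogistic_le a s : 1 <= a -> `|dlogistic a s| <= a + 1.
Proof.
move=> a1; have e0 := expR_gt0 s; rewrite /dlogistic -mulrA normrM.
rewrite gtr0_norm ?ler_piMr; try lra.
rewrite ger0_norm; last by rewrite divr_ge0 ?sqr_ge0//; lra.
rewrite ler_pdivrMr; nra.
Qed.

(* The cubic [y ^+ 3 - y] is decreasing for [3 * y ^+ 2 <= 1], which in terms of
   [s] is [`|s - ln a| <= ln (2 + Num.sqrt 3)]. *)
Lemma ddlogisticE a s : 0 < a -> let y := (expR s - a) / (expR s + a) in
  ddlogistic a s = (a + 1) / (4 * a) * (y ^+ 3 - y).
Proof.
move=> a1 y; have e0 := expR_gt0 s; rewrite /ddlogistic /y; field.
by apply/andP; split; lra.
Qed.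

Lemma norm_ddlogistic_le a s : 1 <= a -> `|ddlogistic a s| <= a + 1.
Proof.
move=> a1; have e0 := expR_gt0 s; rewrite /ddlogistic.
(* Both factors next to [a + 1] have absolute value at most 1. *)
have -> : (a + 1) * expR s * (a - expR s) / (expR s + a) ^+ 3 =
  (a + 1) * (expR s / (expR s + a) ^+ 2 * ((a - expR s) / (expR s + a))) by field; lra.
rewrite normrM gtr0_norm ?ler_piMr; try lra.
rewrite normrM -[leRHS]mulr1 ler_pM//.
  rewrite ger0_norm; last by rewrite divr_ge0 ?sqr_ge0//; lra.
  rewrite ler_pdivrMr; nra.
rewrite ler_norml ler_pdivlMr ?ler_pdivrMr; lra.
Qed.

Lemma ddlogistic_gt0 a s : 0 < a -> s < ln a -> 0 < ddlogistic a s.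
Proof.
move=> a0 sa; have e0 := expR_gt0 s.
have ea : expR s < a by rewrite -[ltRHS]lnK ?posrE// ltr_expR.
by rewrite /ddlogistic divr_gt0 ?exprn_gt0 ?mulr_gt0//; lra.
Qed.

Lemma ddlogistic_lt0 a s : 0 < a -> ln a < s -> ddlogistic a s < 0.
Proof.
move=> a0 sa; have e0 := expR_gt0 s.
have ea : a < expR s by rewrite -[ltLHS]lnK ?posrE// ltr_expR.
rewrite /ddlogistic pmulr_llt0 ?invr_gt0 ?exprn_gt0; try lra.
by rewrite pmulr_rlt0 ?mulr_gt0; lra.
Qed.

(** The variable [y] of [ddlogisticE] increases with [s], and the window confines it to the range
    where the cubic decreases. *)
Lemma ddlogistic_decreasing a s t : 0 < a -> s < t ->
  `|s - ln a| <= ln (2 + Num.sqrt 3) -> `|t - ln a| <= ln (2 + Num.sqrt 3) ->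
  ddlogistic a t < ddlogistic a s.
Proof.
move=> a0 st.
have s3 : (Num.sqrt (3 : R)) ^+ 2 = 3 by rewrite sqr_sqrtr.
have s30 : 0 <= Num.sqrt (3 : R) by exact: sqrtr_ge0.
(* With [e = expR u], the claim reads [e ^+ 2 - 4 * a * e + a ^+ 2 <= 0], whose roots in [e] are
   [a * (2 - Num.sqrt 3)] and [a * (2 + Num.sqrt 3)]. *)
have y2 u : `|u - ln a| <= ln (2 + Num.sqrt 3) ->
    3 * ((expR u - a) / (expR u + a)) ^+ 2 <= 1.
  rewrite ler_norml => /andP[lu ul]; have e0 := expR_gt0 u.
  have eu : expR u <= a * (2 + Num.sqrt 3).
    rewrite -[leRHS]lnK ?posrE ?mulr_gt0; try lra.
    by rewrite ler_expR lnM ?posrE; lra.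
  have ue : a <= expR u * (2 + Num.sqrt 3).
    rewrite -[leLHS]lnK ?posrE// -[leRHS]lnK ?posrE ?mulr_gt0; try lra.
    by rewrite ler_expR lnM ?posrE ?expR_gt0// ?expRK; lra.
  rewrite exprMn exprVn mulrA ler_pdivrMr ?exprn_gt0; try lra.
  (* Here [2 - Num.sqrt 3] is the inverse of [2 + Num.sqrt 3]. *)
  have : a * (2 - Num.sqrt 3) <= expR u by nra.
  nra.
move=> /y2 ys /y2 yt; rewrite !ddlogisticE//.
have est : expR s < expR t by rewrite ltr_expR.
have e0 := expR_gt0 s.
rewrite ltr_pM2l; last by rewrite divr_gt0; lra.
have : (expR s - a) / (expR s + a) < (expR t - a) / (expR t + a).
  rewrite -subr_gt0.
  have -> : (expR t - a) / (expR t + a) - (expR s - a) / (expR s + a) =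
      2 * a * (expR t - expR s) / ((expR s + a) * (expR t + a)).
    by field; apply/andP; split; lra.
  by rewrite divr_gt0 ?mulr_gt0; lra.
move: ys yt.
move: ((_ - _) / _) => y; move: ((_ - _) / _) => z ys zs yz.
(* This product is twice [(y ^+ 3 - y) - (z ^+ 3 - z)]; its last square keeps it positive even at
   the ends of the window. *)
have : 0 < (z - y) * ((1 - 3 * y ^+ 2) + (1 - 3 * z ^+ 2) + (z - y) ^+ 2).
  by rewrite mulr_gt0 ?subr_gt0// ltr_wpDl ?exprn_gt0; lra.
lra.
Qed.

End logistic.

(** * From strict decrease on the middle interval to a single sign change *)

(** The change point is the supremum of the points where [g] is positive: an order argument in place
    of the intermediate value theorem. Below it, a positive value further right propagates to the
    left by monotonicity. *)
Lemma first_pos_then_neg_decreasing (R : realType) (g : R -> R) (a b : R) :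
  0 < a -> a <= b ->
  (forall t, 0 < t < a -> 0 < g t) -> (forall t, b < t -> g t < 0) ->
  (forall s t, a <= s -> s < t -> t <= b -> g t < g s) ->
  first_pos_then_neg g.
Proof.
move=> a0 ab gpos gneg gdec.
pose S := [set t | 0 < t /\ 0 < g t].
have Sb t : S t -> t <= b.
  by move=> [_ gt]; rewrite leNgt; apply/negP => /gneg; lra.
have Sub : has_ubound S by exists b => t /Sb.
have Shalf t : 0 < t < a -> S t by move=> ta; split; [lra|exact: gpos].
have supS : has_sup S by split => //; exists (a / 2); apply: Shalf; lra.
have asup : a <= sup S.
  rewrite leNgt; apply/negP => sa.
  have h0 : 0 < sup S.
    apply: (@lt_le_trans _ _ (a / 2)); first lra.
    by apply: sup_upper_bound => //; apply: Shalf; lra.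
  (* If [sup S < a], this midpoint lies in [S] but above its supremum. *)
  have : (sup S + a) / 2 <= sup S.
    by apply: sup_upper_bound => //; apply: Shalf; lra.
  lra.
exists (sup S); split => [|t /andP[t0 tS]|t St]; first lra.
  have [ta|at_] := ltP t a; first by apply: gpos; lra.
  have [u Su tu] := @sup_adherent _ S (sup S - t) ltac:(lra) supS.
  have [_ gu] := Su; apply: (lt_trans gu); apply: gdec => //; [lra|exact: Sb].
have [tb|bt] := leP t b; last exact: gneg.
(* Lying beyond [sup S] only gives [g <= 0]; comparison with the midpoint makes the inequality
   strict. *)
have : g t < g ((sup S + t) / 2) by apply: gdec; lra.
suff : g ((sup S + t) / 2) <= 0 by lra.
rewrite leNgt; apply/negP => gm.
have : (sup S + t) / 2 <= sup S by apply: sup_upper_bound => //; split => //; lra.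
lra.
Qed.

Lemma measurable_ddlogistic (R : realType) (a : R) :
  0 <= a -> measurable_fun setT (ddlogistic a).
Proof.
move=> a0; apply: derivable_measurable_fun => s.
have ea : expR s + a != 0 by rewrite gt_eqF// ltr_pwDl ?expR_gt0.
have dN := is_deriveM (is_deriveZ (a + 1) (is_derive_expR s))
  (is_deriveB (is_derive_cst a s 1) (is_derive_expR s)).
have := @is_derive_div R _ ((fun s => expR s + a) ^+ 3) s _ _ (expf_neq0 3 ea) dN
  (is_deriveX 3 (is_derive_expRD a s)).
by case.
Qed.

(** * Formula and sign of the second derivative of [FB] *)

Theorem theorem1p19 (R : realType) (d : measure_display)
    (T : measurableType d) (P : probability T R) (W : {RV P >-> R})
    (q : nat) (B w' w : R)
    (hq : (3 <= q)%N)
    (hB : 0 <= B < ln (q%:R - 1))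
    (hw' : 0 < w')
    (hsupp : msupport (distribution P W : set R -> \bar R) `<=` `[w', w])
    (hratio : w / w' <= 1 + ln (2 + Num.sqrt 3) / (ln (q%:R - 1) - B)) :
  twice_derivable_pos (FB W q B) /\ first_pos_then_neg (derive1n 2 (FB W q B)).
Proof.
set a : R := q%:R - 1 in hB hratio.
have a2 : 2 <= a by rewrite /a lerBrDr (_ : 2 + 1 = 3%:R) ?ler_nat//; lra.
set L := ln a - B in hratio.
have L0 : 0 < L by rewrite /L; lra.
(* The event of full probability on which the bounds on [W] hold pointwise; all integrals are taken
   over it. *)
pose D : set T := W @^-1` `[w', w].
have mD : measurable D.
  by rewrite -[D]setTI; exact: measurable_funP.
have PD : P.-negligible (~` D).
  have := negligible_setC_msupport R (distribution P W) _ hsupp.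
  move=> [A [mA A0 CA]]; exists (W @^-1` A); split => //.
    by rewrite -[_ @^-1` _]setTI; exact: measurable_funP.
  by move=> x /= nD; apply: CA.
have D1 : P D != 0%E.
  apply/eqP => PD0; have : P.-negligible [set: T].
    by rewrite -(setUv D); apply: negligibleU => //; exact/negligibleP.
  move/(negligibleP _ measurableT).1 => PT0.
  by have := probability_setT P; rewrite PT0 => /eqP; rewrite eq_sym onee_eq0.
have WD x : D x -> w' <= W x <= w by rewrite /D /= in_itv.
have mW : measurable_fun setT W by exact: measurable_funP.
have W0 x : D x -> 0 < W x by move=> /WD; lra.
have mDW : measurable_fun D W by exact: measurable_funTS.
have W_bd x : D x -> `|W x| <= w.
  by move=> Dx; rewrite gtr0_norm ?W0//; case/andP: (WD x Dx).
set EW := fine ('E_P[W])%E.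
have EW0 : 0 < EW.
  rewrite /EW (@fine_expectation_negligible _ _ _ P D)//; apply: Rintegral_gt0 => //.
  apply: measurable_bounded_integrable => //.
    by rewrite (le_lt_trans (probability_le1 _ _)) ?ltry.
  by exists w; split; [exact: num_real|
    move=> K wK x Dx; apply: le_trans (ltW wK); exact: W_bd].
pose c := EW^-1.
have c0 : 0 < c by rewrite invr_gt0.
have mV0 : measurable_fun D (fun x => W x / EW) by apply: measurable_funM.
have mV1 : measurable_fun D (fun x => W x / EW * W x) by apply: measurable_funM.
have mV2 : measurable_fun D (fun x => W x / EW * W x * W x) by apply: measurable_funM.
have V0_le x : D x -> `|W x / EW| <= w * c.
  by move=> Dx; rewrite normrM (gtr0_norm c0) ler_wpM2r ?W_bd// ltW.
have V1_le x : D x -> `|W x / EW * W x| <= w * c * w.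
  by move=> Dx; rewrite normrM ler_pM ?V0_le ?W_bd.
have V2_le x : D x -> `|W x / EW * W x * W x| <= w * c * w * w.
  by move=> Dx; rewrite normrM ler_pM ?V1_le ?W_bd.
have a0 : 0 <= a by lra.
have a1 : 1 <= a by lra.
have dl (s : R) := is_derive_logistic a s a0.
have ddl (s : R) := is_derive_dlogistic a s a0.
have FBE : FB W q B =
    fun t : R => \int[P]_(x in D) (W x / EW * logistic a (t * W x + B)).
  apply/funext => t; rewrite /FB -/EW.
  have -> : (fun x => W x / EW *
      ((expR (t * W x + B) - 1) / (expR (t * W x + B) + q%:R - 1))) =
      (fun x => W x / EW * logistic a (t * W x + B)).
    by apply/funext => x; rewrite /logistic addrA.
  rewrite (@fine_expectation_negligible _ _ _ P D)//.
  apply: measurable_funM; first exact: measurable_funM.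
  have ml : measurable_fun setT (logistic a).
    by apply: derivable_measurable_fun => s; case: (dl s).
  by apply: (measurableT_comp ml); apply: measurable_funD => //; exact: measurable_funM.
have dF (t : R) : is_derive t 1 (FB W q B)
    (\int[P]_(x in D) (W x / EW * W x * dlogistic a (t * W x + B))).
  rewrite FBE; apply: (is_derive_mul_bounded_comp P D _ W (w * c) w (a + 1)) => // s.
  - exact: norm_logistic_le.
  - exact: norm_dlogistic_le.
have F1E : derive1 (FB W q B) =
    fun t : R => \int[P]_(x in D) (W x / EW * W x * dlogistic a (t * W x + B)).
  by apply/funext => t; rewrite derive1E; exact: derive_val.
have ddF (t : R) : is_derive t 1 (derive1 (FB W q B))
    (\int[P]_(x in D) (W x / EW * W x * W x * ddlogistic a (t * W x + B))).
  rewrite F1E; apply: (is_derive_mul_bounded_comp P D _ W (w * c * w) w (a + 1)) => // s.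
  - exact: norm_dlogistic_le.
  - exact: norm_ddlogistic_le.
split; first by move=> t _; split; exact: ex_derive.
have -> : derive1n 2 (FB W q B) =
    fun t : R => \int[P]_(x in D) (W x / EW * W x * W x * ddlogistic a (t * W x + B)).
  by apply/funext => t; rewrite /= derive1E; exact: derive_val.
have int (t : R) : P.-integrable D
    (EFin \o (fun x => W x / EW * W x * W x * ddlogistic a (t * W x + B))).
  apply: (integrable_mul_bounded_comp P D _ W (w * c * w * w) (a + 1)) => //;
    last exact: measurable_ddlogistic.
  by move=> s; exact: norm_ddlogistic_le.
have V2_gt0 x : D x -> 0 < W x / EW * W x * W x.
  by move=> /W0 Wx; rewrite !mulr_gt0.
(* [D] is not null, hence has a point, whose value under [W] lies between the two bounds. *)
have w'w : w' <= w.
  have [D0|/set0P[x Dx]] := eqVneq D set0; first by rewrite D0 measure0 eqxx in D1.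
  by have /andP[] := WD _ Dx; exact: le_trans.
have w0 : 0 < w by lra.
set K := ln (2 + Num.sqrt 3) in hratio.
(* Since [B - ln a = - L], the quantity lies between [L * (w' / w) - L] and [L * (w / w') - L]. The
   ratio hypothesis bounds the upper end by [K]. *)
have window x (u : R) : D x -> L / w <= u -> u <= L / w' ->
    `|u * W x + B - ln a| <= K.
  move=> Dx; have /andP[Ww' Ww] := WD _ Dx; have Wx0 := W0 _ Dx.
  rewrite ler_pdivrMr// ler_pdivlMr// => Lu uL.
  have LK : L * (w / w') - L <= K.
    have : (w / w' - 1) * L <= K by rewrite -ler_pdivlMr//; lra.
    lra.
  (* This makes the lower deviation [L * (1 - w' / w)] at most the upper one, [L * (w / w' - 1)]. *)
  have ww' : 2 <= w / w' + w' / w.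
    have -> : w / w' + w' / w = 2 + (w - w') ^+ 2 / (w * w').
      by field; apply/andP; split; lra.
    by rewrite lerDl divr_ge0 ?sqr_ge0 ?mulr_ge0// ltW.
  have uW : u * W x <= L * (w / w').
    rewrite mulrA ler_pdivlMr//; nra.
  have Wu : L * (w' / w) <= u * W x.
    rewrite mulrA ler_pdivrMr//; nra.
  have : L * 2 <= L * (w / w' + w' / w) by rewrite ler_pM2l.
  rewrite mulrDr ler_norml /L in uW Wu LK *; rewrite /L; lra.
apply: (@first_pos_then_neg_decreasing _ _ (L / w) (L / w')).
- by rewrite divr_gt0.
- by rewrite ler_pM2l// lef_pV2 ?posrE.
- move=> t /andP[t0]; rewrite ltr_pdivlMr// => tL; apply: Rintegral_gt0 => // x Dx.
  rewrite mulr_gt0 ?V2_gt0// ddlogistic_gt0//; first lra.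
  have /andP[_ Ww] := WD _ Dx.
  have : t * W x <= t * w by rewrite ler_wpM2l// ltW.
  rewrite /L in tL; lra.
- move=> t; rewrite ltr_pdivrMr// => tL.
  (* Negativity becomes a strict comparison with the integral of zero. *)
  have -> : 0 = \int[P]_(x in D) (0 : R) by rewrite Rintegral_cst// mul0r.
  apply: lt_Rintegral => // [|x Dx]; first exact: integrable0.
  rewrite pmulr_rlt0 ?V2_gt0// ddlogistic_lt0//; first lra.
  have /andP[Ww' _] := WD _ Dx.
  have : t * w' <= t * W x by rewrite ler_wpM2l//; nra.
  rewrite /L in tL; lra.
- move=> s t sL st tL; apply: lt_Rintegral => // x Dx.
  rewrite ltr_pM2l ?V2_gt0// ddlogistic_decreasing//.
  + lra.
  + by rewrite ltrD2r ltr_pM2r ?W0.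
  + by apply: window => //; lra.
  + by apply: window => //; lra.
Qed.
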